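(* Let $A\in\mathbb{C}^{n\times n}$ be a Hermitian matrix, and let the columns of the matrices $X,Y\in\mathbb{C}^{n\times p}$ form orthonormal bases of subspaces $\mathcal{X}$ and $\mathcal{Y}$ of $\mathbb{C}^n$, respectively, with $\dim(\mathcal{X})=\dim(\mathcal{Y})=p$. Assume $\Theta(\mathcal{X},\mathcal{Y})<\pi/2$ (all principal angles are less than $\pi/2$). Let $c=\cos(\theta_{\min}(\mathcal{X},\mathcal{Y}))/\cos(\theta_{\max}(\mathcal{X},\mathcal{Y}))$. Then $$\left|\Lambda(X^HAX)-\Lambda(Y^HAY)\right|\prec_w \left\{S(P_{\mathcal{X}+\mathcal{Y}}R_X)+S(P_{\mathcal{X}+\mathcal{Y}}R_Y)\right\}\frac{\sin(\Theta(\mathcal{X},\mathcal{Y}))}{\cos(\theta_{\max}(\mathcal{X},\mathcal{Y}))},$$ $$\left|\Lambda(X^HAX)-\Lambda(Y^HAY)\right|^2\prec_w \left\{S(P_{\mathcal{X}+\mathcal{Y}}R_X)+S(P_{\mathcal{X}+\mathcal{Y}}R_Y)\right\}^2\tan^2(\Theta(\mathcal{X},\mathcal{Y})),$$ $$\left|\Lambda(X^HAX)-\Lambda(Y^HAY)\right|\prec_w \sqrt{c}\left\{S(P_{\mathcal{X}+\mathcal{Y}}R_X)+S(P_{\mathcal{X}+\mathcal{Y}}R_Y)\right\}\tan(\Theta(\mathcal{X},\mathcal{Y})).$$ In addition, if the subspace $\mathcal{X}$ is $A$-invariant, then correspondingly $$\left|\Lambda(X^HAX)-\Lambda(Y^HAY)\right|\prec_w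 S(P_{\mathcal{X}+\mathcal{Y}}R_Y)\frac{\sin(\Theta(\mathcal{X},\mathcal{Y}))}{\cos(\theta_{\max}(\mathcal{X},\mathcal{Y}))},$$ $$\left|\Lambda(X^HAX)-\Lambda(Y^HAY)\right|^2\prec_w S^2(P_{\mathcal{X}+\mathcal{Y}}R_Y)\tan^2(\Theta(\mathcal{X},\mathcal{Y})),$$ $$\left|\Lambda(X^HAX)-\Lambda(Y^HAY)\right|\prec_w \sqrt{c}\,S(P_{\mathcal{X}+\mathcal{Y}}R_Y)\tan(\Theta(\mathcal{X},\mathcal{Y})).$$
   Context: $\Lambda(\cdot)$ is the vector of eigenvalues of a Hermitian matrix in decreasing order. $S(\cdot)$ is the vector of singular values of a matrix in decreasing order (for an $n\times p$ matrix with $p\le n$, it has $p$ entries), and $S^2(\cdot)$ is its entry-wise square. $R_X=AX-X(X^HAX)$ and $R_Y=AY-Y(Y^HAY)$ are the residual matrices. $P_{\mathcal{X}+\mathcal{Y}}$ is the orthogonal projector onto the subspace $\mathcal{X}+\mathcal{Y}$. The principal angles between $\mathcal{X}$ and $\mathcal{Y}$ lie in $[0,\pi/2]$ and are the numbers whose cosines are the singular values of $X^HY$; $\Theta(\mathcal{X},\mathcal{Y})$ is the vector of these $p$ angles in decreasing order, and $\theta_{\max}(\mathcal{X},\mathcal{Y})$, $\theta_{\min}(\mathcal{X},\mathcal{Y})$ are the largest and smallest of them. A subspace $\mathcal{X}$ is $A$-invariant if $A\mathcal{X}\subset\mathcal{X}$. All operations on vectors (sum, product, quotient, square, absolute value,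 trigonometric functions) are entry-wise, in the given orderings. For $x,y\in\mathbb{R}^m$, $x\prec_w y$ (weak majorization) means that, after rearranging the entries of each vector in decreasing order $x_1\ge\dots\ge x_m$, $y_1\ge\dots\ge y_m$, one has $\sum_{i=1}^k x_i\le\sum_{i=1}^k y_i$ for all $1\le k\le m$. *)

(* Defs.v *)
From mathcomp Require Import all_boot all_order all_algebra.
From mathcomp Require Import sesquilinear spectral.
From mathcomp Require Import complex.
From mathcomp Require Import reals trigo.

Set Implicit Arguments.
Unset Strict Implicit.
Unset Printing Implicit Defensive.

Import Order.TTheory GRing.Theory Num.Theory.

Local Open Scope ring_scope.
Local Open Scope complex_scope.
Local Open Scope sesquilinear_scope.

Definition decr (R : realType) (s : seq R) : seq R := sort >=%R s.

(* Characteristic roots, repeated according to multiplicity.  They are real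
   when A is Hermitian, so that taking real parts only changes their type. *)
Definition eigvals (R : realType) (n : nat) (A : 'M[R[i]]_n) : 'rV[R]_n :=
  \row_(i < n)
    (decr [seq complex.Re z |
             z <- sval (closed_field_poly_normal (char_poly A))])`_i.

(* Always q entries, which is the usual vector of singular values when
   q <= m. *)
Definition singvals (R : realType) (m q : nat) (B : 'M[R[i]]_(m, q)) :
    'rV[R]_q :=
  \row_(i < q) Num.sqrt (eigvals (B^t* *m B) 0 i).

(* X and Y have orthonormal columns.  Since acos is decreasing, reversing the
   singular values of X^H Y lists the angles in decreasing order. *)
Definition angles (R : realType) (n p : nat) (X Y : 'M[R[i]]_(n, p)) :
    'rV[R]_p :=
  \row_(i < p) acos (singvals (X^t* *m Y) 0 (rev_ord i)).

(* The default values 0 and pi / 2 are the bounds of the range of the angles,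
   so they do not affect the result when 0 < p. *)
Definition theta_max (R : realType) (n p : nat) (X Y : 'M[R[i]]_(n, p)) : R :=
  \big[Num.max/0]_(i < p) angles X Y 0 i.

Definition theta_min (R : realType) (n p : nat) (X Y : 'M[R[i]]_(n, p)) : R :=
  \big[Num.min/pi / 2]_(i < p) angles X Y 0 i.

(* Subspaces are column spaces here, whereas proj_ortho acts on row vectors
   (u |-> u *m proj_ortho U) and projects onto a row space: hence the
   transposes. *)
Definition proj_sum (R : realType) (n p : nat) (X Y : 'M[R[i]]_(n, p)) :
    'M[R[i]]_n :=
  (proj_ortho (X^T + Y^T)%MS)^T.

Definition residual (R : realType) (n p : nat)
    (A : 'M[R[i]]_n) (X : 'M[R[i]]_(n, p)) : 'M[R[i]]_(n, p) :=
  A *m X - X *m (X^t* *m A *m X).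

(* A X is contained in X, for the column space of X. *)
Definition invariant_colspace (R : realType) (n p : nat)
    (A : 'M[R[i]]_n) (X : 'M[R[i]]_(n, p)) : bool :=
  stablemx X^T A^T.

Definition wmajorized (R : realType) (m : nat) (x y : 'rV[R]_m) : Prop :=
  forall k : nat, (1 <= k <= m)%N ->
    \sum_(i < k) (decr [seq x 0 j | j <- enum 'I_m])`_i <=
    \sum_(i < k) (decr [seq y 0 j | j <- enum 'I_m])`_i.
Notation "x '<w' y" := (wmajorized x y) (at level 70, no associativity).

(* Main.v *)
Require Import Defs.
From mathcomp Require Import all_boot all_order all_algebra.
From mathcomp Require Import fingroup perm sesquilinear spectral complex reals trigo.
From mathcomp Require Import ring lra.

(** All six bounds follow from a single weak majorization:
      |Lambda(X^H A X) - Lambda(Y^H A Y)| is weakly majorized by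
      {S(P R_X) + S(P R_Y)} tan(Theta).
    Indeed [tan] is at most [sin / cos theta_max], the constant [c] is at least 1,
    and squaring nonnegative vectors preserves weak majorization.  When the
    column space of [X] is invariant, [R_X] vanishes.

    To prove it, rotate the two bases by a singular value decomposition of
    [X^H Y], which changes neither the Ritz values nor the singular values of
    the residuals; now [X^H Y = T] is diagonal, with the cosines of the angles
    as entries.  Put [H = X^H A X], [K = Y^H A Y], [D = H - K].  Expanding the
    residuals gives
      H T - T K = X^H R_Y - R_X^H Y.
    By Lidskii's theorem in its absolute value form ([lidskii_abs]) it suffices
    to bound the sums of the k largest absolute eigenvalues of [D].  With
    [N = T^(1/2)], the matrices [N^-1 D N] and [N D N^-1] are adjoint to each
    other and similar to [D]; a Gram-Schmidt basis [Q] makes the first one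
    triangular, so that both have the eigenvalues [d_i] of [D] on the diagonal
    ([real_diag_of_similar]).  Replacing in the difference of
    [N^-1 H N] and [N^-1 K N] the second term by its adjoint,
      d_i = Re (Q N^-1 (H T - T K) N^-1 Q^H)_ii.
    Hence a sum of k numbers [|d_i|] is at most the sum of two traces of [W Z],
    where [W] is a contraction of rank at most k and [Z] is
    [N^-1 X^H R_Y N^-1], respectively [N^-1 Y^H R_X N^-1].

    Finally [X^H R_Y = ((1 - Y Y^H) X)^H P R_Y], the singular values of
    [(1 - Y Y^H) X] being the sines of the angles.  So [Z] is a product of
    contractions and of nonnegative diagonal matrices with entries
    [cos^(-1/2)], [sin], [S(P R_Y)] and [cos^(-1/2)], all decreasing.  The
    bound on such traces is multiplicative ([sv_dominated_rdiag], an Abel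
    summation), which yields [S(P R_Y) tan(Theta)]. *)

Import Order.TTheory GRing.Theory Num.Theory.
Local Open Scope ring_scope.
Local Open Scope complex_scope.
Local Open Scope sesquilinear_scope.

Set Implicit Arguments.
Unset Strict Implicit.
Unset Printing Implicit Defensive.

(** * Partial sums and weak majorization *)

Definition nonincreasing (R : realType) p (s : 'I_p -> R) : Prop :=
  forall i j : 'I_p, (i <= j)%N -> s j <= s i.

(** By summation by parts: a nonincreasing nonnegative sequence is a nonnegative
    combination of indicators of initial segments. *)
Lemma abel_sum_ge0 (R : realType) p (s a : 'I_p -> R) :
  nonincreasing s -> (forall i, 0 <= s i) ->
  (forall k, 0 <= \sum_(i < p | (i < k)%N) a i) ->
  0 <= \sum_i s i * a i.
Proof.
elim: p s a => [|p IHp] s a sdec s0 a0; first by rewrite big_ord0.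
have -> : \sum_i s i * a i =
    \sum_(i < p) (s (widen_ord (leqnSn p) i) - s ord_max) *
                 a (widen_ord (leqnSn p) i) + s ord_max * \sum_i a i.
  rewrite big_ord_recr /=.
  rewrite big_ord_recr /= mulrDr addrA mulr_sumr -big_split /=; congr (_ + _).
  by apply: eq_bigr => i _; rewrite mulrBl subrK.
apply: addr_ge0; last first.
  apply: mulr_ge0 => //; have := a0 p.+1.
  by rewrite (eq_bigl predT) // => i /=; rewrite ltn_ord.
apply: IHp => [i j ij|i|k].
- by rewrite lerD2r sdec.
- by rewrite subr_ge0 sdec //= ltnW.
- rewrite (_ : \sum_(i < p | _) _ = \sum_(i < p.+1 | (i < minn k p)%N) a i) //.
  rewrite big_mkcond [RHS]big_mkcond big_ord_recr /= ltnNge geq_minr /= addr0.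
  by apply: eq_bigr => i _; rewrite leq_min ltn_ord andbT.
Qed.

Lemma abel_sum_le (R : realType) p (s x y : 'I_p -> R) :
  nonincreasing s -> (forall i, 0 <= s i) ->
  (forall k, \sum_(i < p | (i < k)%N) x i <= \sum_(i < p | (i < k)%N) y i) ->
  \sum_i s i * x i <= \sum_i s i * y i.
Proof.
move=> sdec s0 xy; rewrite -subr_ge0 -sumrB.
under eq_bigr do rewrite -mulrBr.
by apply: abel_sum_ge0 => // k; rewrite sumrB subr_ge0.
Qed.

(** Expresses prefixes of a sorted list through a permutation of the index set, so
    that sums over them can be reindexed. *)
Lemma decr_perm (R : realType) p (x : 'I_p -> R) :
  exists2 g : 'S_p, nonincreasing (x \o g) &
    forall i : 'I_p, (decr [seq x j | j <- enum 'I_p])`_i = x (g i).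
Proof.
have szd : size (decr [seq x j | j <- enum 'I_p]) == p.
  by rewrite size_sort size_map size_enum_ord.
pose t := map_tuple x (ord_tuple p).
have /tuple_permP[g Eg] : perm_eq (Tuple szd) t by rewrite perm_sort.
have Hn (i : 'I_p) : (decr [seq x j | j <- enum 'I_p])`_i = x (g i).
  have := tnth_mktuple (fun j => tnth t (g j)) i.
  by rewrite (tnth_nth 0) -Eg /= tnth_map tnth_ord_tuple.
exists g => // i j ij /=; rewrite -!Hn.
apply: (@sorted_leq_nth _ >=%R); rewrite ?inE ?(eqP szd) //.
- by move=> b a c /= ab bc; exact: le_trans bc ab.
- by move=> a /=; exact: lexx.
by rewrite /decr sort_sorted // => a b; exact: le_total.
Qed.

Lemma nth_decr_nonincreasing (R : realType) p (y : 'I_p -> R) (i : 'I_p) :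
  nonincreasing y -> (decr [seq y j | j <- enum 'I_p])`_i = y i.
Proof.
move=> ydec; rewrite /decr sorted_sort.
- by rewrite (nth_map i) ?size_enum_ord // nth_ord_enum.
- by move=> b a c /= ab bc; exact: le_trans bc ab.
rewrite sorted_map; apply: (@sub_sorted _ (relpre val leq)).
  by move=> a b /= /ydec.
by rewrite -sorted_map val_enum_ord iota_sorted.
Qed.

Lemma wmajorizedP (R : realType) p (x y : 'I_p -> R) :
  nonincreasing y ->
  (forall (g : 'S_p) (k : nat), nonincreasing (x \o g) -> (k <= p)%N ->
     \sum_(i < p | (i < k)%N) x (g i) <= \sum_(i < p | (i < k)%N) y i) ->
  \row_i x i <w \row_i y i.
Proof.
move=> ydec H k /andP[_ kp].
have [g gdec Eg] := decr_perm x.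
have nx f : \sum_(i < k) (decr [seq f j | j <- enum 'I_p])`_i =
    \sum_(i < p | (i < k)%N) (decr [seq f j | j <- enum 'I_p])`_i :> R.
  exact: (big_ord_widen _ (fun i => (decr [seq f j | j <- enum 'I_p])`_i) kp).
rewrite (eq_map (fun j => mxE _ _ _ _)) (eq_map (fun j => mxE _ _ _ _)) !nx.
under eq_bigr do rewrite Eg.
under [leRHS]eq_bigr do rewrite nth_decr_nonincreasing //.
exact: H.
Qed.

Lemma abel_partial_sum_le (R : realType) p (s x y : 'I_p -> R) k :
  nonincreasing s -> (forall i, 0 <= s i) ->
  (forall k, \sum_(i < p | (i < k)%N) x i <= \sum_(i < p | (i < k)%N) y i) ->
  \sum_(i < p | (i < k)%N) s i * x i <= \sum_(i < p | (i < k)%N) s i * y i.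
Proof.
move=> sdec s0 xy; pose t (i : 'I_p) := if (i < k)%N then s i else 0.
have tE z : \sum_(i < p | (i < k)%N) s i * z i = \sum_i t i * z i.
  by rewrite big_mkcond; apply: eq_bigr => i _; rewrite /t; case: ifP; rewrite ?mul0r.
rewrite !tE; apply: abel_sum_le => // [i j ij|i]; rewrite /t; last by case: ifP.
case: ifP => jk; last by case: ifP.
by rewrite (leq_ltn_trans ij jk) sdec.
Qed.

(** Weak majorization of nonincreasing nonnegative vectors survives squaring:
    summation by parts bounds the sums of x^2 by those of x y (weights x), and the
    latter by those of y^2 (weights y). *)
Lemma partial_sum_sqr_le (R : realType) p (x y : 'I_p -> R) k :
  nonincreasing x -> nonincreasing y ->
  (forall i, 0 <= x i) -> (forall i, 0 <= y i) ->
  (forall k, \sum_(i < p | (i < k)%N) x i <= \sum_(i < p | (i < k)%N) y i) ->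
  \sum_(i < p | (i < k)%N) x i ^+ 2 <= \sum_(i < p | (i < k)%N) y i ^+ 2.
Proof.
move=> xdec ydec x0 y0 xy.
have xx_xy := abel_partial_sum_le k xdec x0 xy.
have yx_yy := abel_partial_sum_le k ydec y0 xy.
apply: le_trans xx_xy (le_trans _ yx_yy).
by under eq_bigr do rewrite mulrC.
Qed.

(** * Adjoints, real diagonal matrices and quadratic forms *)

Lemma adjmx_mul (R : realType) m n p (A : 'M[R[i]]_(m, n)) (B : 'M[R[i]]_(n, p)) :
  (A *m B)^t* = B^t* *m A^t*.
Proof. by rewrite trmx_mul map_mxM. Qed.

Lemma adjmxD (R : realType) m n (A B : 'M[R[i]]_(m, n)) :
  (A + B)^t* = A^t* + B^t*.
Proof. by rewrite linearD map_mxD. Qed.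

Lemma adjmxB (R : realType) m n (A B : 'M[R[i]]_(m, n)) :
  (A - B)^t* = A^t* - B^t*.
Proof. by rewrite linearB map_mxB. Qed.

Lemma adjmx1 (R : realType) n : (1%:M : 'M[R[i]]_n)^t* = 1%:M.
Proof. by rewrite trmx1 map_mx1. Qed.

Lemma hermsymmxE (R : realType) n (A : 'M[R[i]]_n) :
  (A \is hermsymmx) = (A^t* == A).
Proof.
by apply/is_hermitianmxP/eqP => [|->]; rewrite expr0 scale1r // => <-.
Qed.

Lemma unitarymx_tK (R : realType) n (U : 'M[R[i]]_n) :
  U \is unitarymx -> U^t* *m U = 1%:M.
Proof. by rewrite -trmxC_unitary => /unitarymxP; rewrite trmxCK. Qed.

Definition rdiag_mx (R : realType) n (s : 'I_n -> R) : 'M[R[i]]_n :=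
  diag_mx (\row_i (s i)%:C).

Lemma rdiag_mxE (R : realType) n (s : 'I_n -> R) i j :
  rdiag_mx s i j = (s i)%:C *+ (i == j).
Proof. by rewrite !mxE; case: eqVneq => [->|]. Qed.

Lemma eq_rdiag_mx (R : realType) n (s t : 'I_n -> R) :
  s =1 t -> rdiag_mx s = rdiag_mx t.
Proof. by move=> st; apply/matrixP => i j; rewrite !rdiag_mxE st. Qed.

Lemma rdiag_mxM (R : realType) n (s t : 'I_n -> R) :
  rdiag_mx s *m rdiag_mx t = rdiag_mx (fun i => s i * t i).
Proof.
by rewrite mulmx_diag; congr diag_mx; apply/rowP => i; rewrite !mxE rmorphM.
Qed.

Lemma rdiag_mx1 (R : realType) n : rdiag_mx (fun _ : 'I_n => 1 : R) = 1%:M.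
Proof. by apply/matrixP => i j; rewrite rdiag_mxE mxE. Qed.

Lemma adj_rdiag_mx (R : realType) n (s : 'I_n -> R) : (rdiag_mx s)^t* = rdiag_mx s.
Proof.
rewrite tr_diag_mx map_diag_mx; congr diag_mx; apply/rowP => i.
by rewrite !mxE; exact: conjc_real.
Qed.

Lemma mul_mx_rdiagE (R : realType) m n (A : 'M[R[i]]_(m, n)) (s : 'I_n -> R) i j :
  (A *m rdiag_mx s) i j = A i j * (s j)%:C.
Proof. by rewrite mul_mx_diag !mxE. Qed.

Lemma mul_rdiag_mxE (R : realType) m n (A : 'M[R[i]]_(m, n)) (s : 'I_m -> R) i j :
  (rdiag_mx s *m A) i j = (s i)%:C * A i j.
Proof. by rewrite mul_diag_mx !mxE. Qed.

Lemma Re_add (R : realType) (a b : R[i]) : complex.Re (a + b) = complex.Re a + complex.Re b.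
Proof. by case: a => x y; case: b. Qed.

Lemma Re_opp (R : realType) (a : R[i]) : complex.Re (- a) = - complex.Re a.
Proof. by case: a. Qed.

Lemma Re_sum (R : realType) (I : Type) (r : seq I) (P : pred I) (F : I -> R[i]) :
  complex.Re (\sum_(j <- r | P j) F j) = \sum_(j <- r | P j) complex.Re (F j).
Proof. by apply: (big_morph (@complex.Re R)) => // a b; rewrite Re_add. Qed.

Lemma Re_conj (R : realType) (a : R[i]) : complex.Re (Num.conj a) = complex.Re a.
Proof. by case: a. Qed.

Lemma Re_mul_real (R : realType) (a : R) (b : R[i]) :
  complex.Re (a%:C * b) = a * complex.Re b.
Proof. by case: b => x y /=; rewrite mul0r subr0. Qed.

Definition sqr_modulus (R : realType) (z : R[i]) : R :=
  complex.Re z ^+ 2 + complex.Im z ^+ 2.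

Lemma sqr_modulus_ge0 (R : realType) (z : R[i]) : 0 <= sqr_modulus z.
Proof. by rewrite addr_ge0 // sqr_ge0. Qed.

Lemma sqr_modulus_eq0 (R : realType) (z : R[i]) : (sqr_modulus z == 0) = (z == 0).
Proof. by rewrite paddr_eq0 ?sqr_ge0 // !sqrf_eq0 eq_complex. Qed.

Lemma mul_conjE (R : realType) (z : R[i]) : z * Num.conj z = (sqr_modulus z)%:C.
Proof.
rewrite /sqr_modulus; case: z => x y; apply/eqP; rewrite eq_complex /=.
by apply/andP; split; apply/eqP; ring.
Qed.

(** The real part only changes the type of the value when the matrix is Hermitian. *)
Definition qform (R : realType) n (H : 'M[R[i]]_n) (v : 'rV[R[i]]_n) : R :=
  complex.Re ((v *m H *m v^t*) 0 0).

Lemma qformD (R : realType) n (H K : 'M[R[i]]_n) v :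
  qform (H + K) v = qform H v + qform K v.
Proof. by rewrite /qform mulmxDr mulmxDl mxE Re_add. Qed.

Lemma qform_conj (R : realType) m n (H : 'M[R[i]]_m) (B : 'M[R[i]]_(m, n)) v :
  qform (B^t* *m H *m B) v = qform H (v *m B^t*).
Proof. by rewrite /qform adjmx_mul trmxCK !mulmxA. Qed.

Lemma qform_rdiag (R : realType) n (s : 'I_n -> R) v :
  qform (rdiag_mx s) v = \sum_i s i * sqr_modulus (v 0 i).
Proof.
rewrite /qform mxE Re_sum; apply: eq_bigr => i _.
by rewrite mul_mx_rdiagE mulrAC !mxE mul_conjE -rmorphM mulrC.
Qed.

Lemma qform1 (R : realType) n (v : 'rV[R[i]]_n) :
  qform 1%:M v = \sum_i sqr_modulus (v 0 i).
Proof. by rewrite -rdiag_mx1 qform_rdiag; under eq_bigr do rewrite mul1r. Qed.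

Lemma qform1_gt0 (R : realType) n (v : 'rV[R[i]]_n) : v != 0 -> 0 < qform 1%:M v.
Proof.
move=> v0; rewrite qform1 lt_def sumr_ge0 ?andbT => [|i _]; last exact: sqr_modulus_ge0.
apply: contra v0; rewrite psumr_eq0 => [/allP z0|i _]; last exact: sqr_modulus_ge0.
apply/eqP/rowP => i; rewrite mxE; apply/eqP; rewrite -sqr_modulus_eq0.
exact: z0 (mem_index_enum i).
Qed.

(** * Spectral decompositions with ordered eigenvalues *)

Definition spectral_form (R : realType) n (H : 'M[R[i]]_n) (l : 'I_n -> R)
    (U : 'M[R[i]]_n) : Prop :=
  [/\ U \is unitarymx, H = U^t* *m rdiag_mx l *m U & nonincreasing l].

Lemma char_poly_unitary (R : realType) n (U H : 'M[R[i]]_n) :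
  U \is unitarymx -> char_poly (U^t* *m H *m U) = char_poly H.
Proof.
move=> Uu; pose V := map_mx polyC U; pose W := map_mx polyC (U^t*).
have WV : W *m V = 1%:M by rewrite -map_mxM unitarymx_tK // map_mx1.
rewrite /char_poly /char_poly_mx !map_mxM -/V -/W.
have -> : 'X%:M - W *m map_mx polyC H *m V = W *m ('X%:M - map_mx polyC H) *m V.
  by rewrite mulmxBr mulmxBl -(mulmxA W 'X%:M) -scalar_mxC mulmxA WV mul1mx.
by rewrite !det_mulmx mulrAC -det_mulmx WV det1 mul1r.
Qed.

(** The characteristic polynomial has the diagonal entries as roots, so the sorted
    list of its roots is the nonincreasing diagonal itself. *)
Lemma spectral_form_eigvals (R : realType) n (H : 'M[R[i]]_n) l U :
  spectral_form H l U -> forall i, eigvals H 0 i = l i.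
Proof.
move=> [Uu HE ldec] i; rewrite mxE; case: closed_field_poly_normal => r /= Er.
rewrite (monicP (char_poly_monic H)) scale1r HE char_poly_unitary // in Er.
rewrite char_poly_trig ?diag_mx_is_trig // in Er.
have /perm_map : perm_eq r [seq (l j)%:C | j <- enum 'I_n].
  apply/prod_XsubC_eq; rewrite -Er big_map big_enum /=.
  by apply: eq_bigr => j _; rewrite rdiag_mxE eqxx.
move=> /(_ _ (@complex.Re R)); rewrite -map_comp => rE.
rewrite -(nth_decr_nonincreasing i ldec); congr (_ `_ i).
apply/perm_sortP => // [a b|b a c ab bc|a b].
- exact: le_total.
- exact: le_trans bc ab.
- by rewrite andbC; exact: le_anti.
Qed.

Lemma spectral_form_mul_unitary (R : realType) n (H U Q : 'M[R[i]]_n) l :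
  spectral_form H l U -> Q \is unitarymx ->
  spectral_form (Q^t* *m H *m Q) l (U *m Q).
Proof.
move=> [Uu -> ldec] Qu; split; [exact: mul_unitarymx | | exact: ldec].
by rewrite adjmx_mul !mulmxA.
Qed.

Lemma unitary_row_perm (R : realType) n (U : 'M[R[i]]_n) (g : 'S_n) :
  U \is unitarymx -> row_perm g U \is unitarymx.
Proof.
move=> Uu; apply/unitarymxP; rewrite row_permE adjmx_mul mulmxA mulmxtVK //.
by rewrite tr_perm_mx map_perm_mx -perm_mxM mulgV perm_mx1.
Qed.

Lemma unitary_rdiag_row_perm (R : realType) n (U : 'M[R[i]]_n) l (g : 'S_n) :
  (row_perm g U)^t* *m rdiag_mx (l \o g) *m row_perm g U = U^t* *m rdiag_mx l *m U.
Proof.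
rewrite row_permE adjmx_mul !mulmxA; congr (_ *m _).
rewrite -!mulmxA; congr (_ *m _).
apply/matrixP => i j; rewrite tr_perm_mx map_perm_mx.
rewrite -row_permE -[in X in row_perm _ (_ *m X)](invgK g) -col_permE !mxE /=.
by rewrite (inj_eq perm_inj) permKV.
Qed.

Lemma hermitian_spectral_form (R : realType) n (H : 'M[R[i]]_n) :
  H^t* = H -> exists U, spectral_form H (eigvals H 0) U.
Proof.
move=> /eqP; rewrite -hermsymmxE => Hh.
have dr := hermitian_spectral_diag_real Hh.
have /hermitian_normalmx/orthomx_spectralP := Hh.
set U := spectralmx H; set d := spectral_diag H => HE.
have Uu : U \is unitarymx := spectral_unitarymx H.
pose l i := complex.Re (d 0 i).
have [g gdec _] := decr_perm l.
have dE : diag_mx d = rdiag_mx l.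
  by apply/matrixP => i j; rewrite rdiag_mxE mxE RRe_real // (mxOverP dr).
have HV : spectral_form H (l \o g) (row_perm g U).
  split; [exact: unitary_row_perm | | exact: gdec].
  by rewrite unitary_rdiag_row_perm -dE -invmx_unitary.
exists (row_perm g U); case: (HV) => Vu HVE _; split; first exact: Vu.
  rewrite [LHS]HVE; do 2!congr (_ *m _); apply: eq_rdiag_mx => i.
  by rewrite (spectral_form_eigvals HV).
by move=> i j ij; rewrite !(spectral_form_eigvals HV) gdec.
Qed.

(** * Weyl monotonicity and the theorem of Lidskii *)

Lemma qform1_unitary (R : realType) n (U : 'M[R[i]]_n) v :
  U \is unitarymx -> qform 1%:M (v *m U^t*) = qform 1%:M v.
Proof. by move=> Uu; rewrite -qform_conj mulmx1 unitarymx_tK. Qed.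

Lemma spectral_form_qform_ge (R : realType) n (H : 'M[R[i]]_n) l U v (i : 'I_n) :
  spectral_form H l U -> (forall j : 'I_n, (i < j)%N -> (v *m U^t*) 0 j = 0) ->
  l i * qform 1%:M v <= qform H v.
Proof.
move=> [Uu -> ldec] v0; rewrite qform_conj qform_rdiag -(qform1_unitary _ Uu).
rewrite qform1 mulr_sumr ler_sum // => j _.
have [ji|ij] := leqP j i; first by rewrite ler_wpM2r ?sqr_modulus_ge0 ?ldec.
by rewrite v0 // /sqr_modulus /= expr0n addr0 !mulr0.
Qed.

Lemma spectral_form_qform_le (R : realType) n (H : 'M[R[i]]_n) l U v (i : 'I_n) :
  spectral_form H l U -> (forall j : 'I_n, (j < i)%N -> (v *m U^t*) 0 j = 0) ->
  qform H v <= l i * qform 1%:M v.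
Proof.
move=> [Uu -> ldec] v0; rewrite qform_conj qform_rdiag -(qform1_unitary _ Uu).
rewrite qform1 mulr_sumr ler_sum // => j _.
have [ij|ji] := leqP i j; first by rewrite ler_wpM2r ?sqr_modulus_ge0 ?ldec.
by rewrite v0 // /sqr_modulus /= expr0n addr0 !mulr0.
Qed.

(** Dimension count: the span of the first i + 1 rows of U and the orthogonal
    complement of the first i rows of W meet, since i + 1 coefficients are subject
    to i linear equations. *)
Lemma unitary_flags_meet (R : realType) n (U W : 'M[R[i]]_n) (i : 'I_n) :
  U \is unitarymx ->
  exists v : 'rV_n, [/\ v != 0,
    forall j : 'I_n, (i < j)%N -> (v *m U^t*) 0 j = 0 &
    forall j : 'I_n, (j < i)%N -> (v *m W^t*) 0 j = 0].
Proof.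
move=> Uu; pose A := rowsub (widen_ord (ltn_ord i)) U.
pose B := rowsub (widen_ord (ltnW (ltn_ord i))) W.
have AU j (k : 'I_i.+1) : (A *m U^t*) k j = (widen_ord (ltn_ord i) k == j)%:R.
  by rewrite mul_rowsub_mx (unitarymxP Uu) !mxE.
have /rowV0Pn[a /sub_kermxP aC a0] : kermx (A *m B^t*) != 0.
  by rewrite -mxrank_eq0 mxrank_ker subn_eq0 -ltnNge ltnS rank_leq_col.
exists (a *m A); split=> [|j ij|j ji].
- apply: contra a0 => /eqP aA0; apply/eqP/rowP => k.
  have : (a *m A *m U^t*) 0 (widen_ord (ltn_ord i) k) = 0.
    by rewrite aA0 mul0mx mxE.
  rewrite -mulmxA mxE (bigD1 k) //= AU eqxx mulr1 big1 ?addr0 ?mxE // => k' k'k.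
  by rewrite AU -val_eqE /= val_eqE (negPf k'k) mulr0.
- rewrite -mulmxA mxE big1 // => k _; rewrite AU; case: eqP => [kj|]; last by rewrite mulr0.
  by move: ij; rewrite -kj ltnNge /= -ltnS ltn_ord.
have /matrixP/(_ 0 (Ordinal ji)) := aC.
rewrite mulmxA mxE [RHS]mxE => <-; rewrite mxE; apply: eq_bigr => k _.
by congr (_ * _); rewrite !mxE; congr (Num.conj (W _ _)); apply: val_inj.
Qed.

(** Both quadratic forms are compared on a vector on which H is at least its i-th
    eigenvalue and K at most its own. *)
Lemma weyl_monotone (R : realType) n (H K : 'M[R[i]]_n) l m U W s (i : 'I_n) :
  spectral_form H l U -> spectral_form K m W ->
  (forall v, qform H v <= qform K v + s * qform 1%:M v) ->
  l i <= m i + s.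
Proof.
move=> Hl Km HK; case: (Hl) => Uu _ _.
have [v [v0 vU vW]] := unitary_flags_meet W i Uu.
rewrite -(ler_pM2r (qform1_gt0 v0)) mulrDl.
apply: le_trans (spectral_form_qform_ge Hl vU) (le_trans (HK v) _).
by rewrite lerD2r (spectral_form_qform_le Km vW).
Qed.

Lemma trace_unitary_rdiag (R : realType) n (U : 'M[R[i]]_n) d :
  U \is unitarymx -> complex.Re (\tr (U^t* *m rdiag_mx d *m U)) = \sum_i d i.
Proof.
move=> Uu; rewrite mxtrace_mulC mulmxA (unitarymxP Uu) mul1mx mxtrace_diag Re_sum.
by apply: eq_bigr => i _; rewrite mxE.
Qed.

Lemma adj_unitary_rdiag (R : realType) n (U : 'M[R[i]]_n) d :
  (U^t* *m rdiag_mx d *m U)^t* = U^t* *m rdiag_mx d *m U.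
Proof. by rewrite !adjmx_mul trmxCK adj_rdiag_mx mulmxA. Qed.

(** One half of Lidskii's theorem.  Let P be the positive part of D - s, for D the
    perturbation; then H is at most K + P + s and K at most K + P, so the gaps
    between the eigenvalues of K + P and K are nonnegative, sum up to the trace of
    P, and control the increase of the eigenvalues beyond s. *)
Lemma eigenvalue_shift_bound (R : realType) n (H K U : 'M[R[i]]_n) l m V W d s :
  spectral_form H l V -> spectral_form K m W ->
  U \is unitarymx -> H = K + U^t* *m rdiag_mx d *m U ->
  exists g : 'I_n -> R, [/\ forall i, 0 <= g i, forall i, l i - m i <= s + g i &
    \sum_i g i = \sum_i Num.max (d i - s) 0].
Proof.
move=> Hl Km Uu HE.
pose P := U^t* *m rdiag_mx (fun i => Num.max (d i - s) 0) *m U.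
have [V' eV'] : exists V', spectral_form (K + P) (eigvals (K + P) 0) V'.
  apply: hermitian_spectral_form; rewrite adjmxD adj_unitary_rdiag.
  by case: Km => _ KE _; congr (_ + _); rewrite KE; exact: adj_unitary_rdiag.
exists (fun i => eigvals (K + P) 0 i - m i); split=> [i|i|].
- rewrite subr_ge0 -[leRHS]addr0; apply: weyl_monotone Km eV' _ => v.
  rewrite mul0r addr0 qformD lerDl /P qform_conj qform_rdiag sumr_ge0 // => j _.
  by rewrite mulr_ge0 ?sqr_modulus_ge0 // le_max lexx orbT.
- suff : l i <= eigvals (K + P) 0 i + s by lra.
  apply: weyl_monotone Hl eV' _ => v.
  rewrite HE (qformD K) (qformD K) -addrA lerD2l /P.
  rewrite (qform_conj (rdiag_mx d) U) (qform_conj (rdiag_mx _) U) !qform_rdiag.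
  rewrite -(qform1_unitary v Uu) qform1 mulr_sumr -big_split ler_sum //= => j _.
  rewrite -mulrDl ler_wpM2r ?sqr_modulus_ge0 // -lerBlDr.
  by rewrite le_max lexx.
rewrite sumrB -(trace_unitary_rdiag (fun i => Num.max (d i - s) 0) Uu) -/P.
case: eV' => V'u KPE _; rewrite -(trace_unitary_rdiag (eigvals (K + P) 0) V'u) -KPE.
case: Km => Wu KE _; rewrite -(trace_unitary_rdiag m Wu) -KE.
by rewrite mxtraceD Re_add addrC addKr.
Qed.

(** The theorems of Lidskii and Mirsky.  The sum of the k largest of the |d_i| is
    k s plus the sum of the positive parts of |d_i| - s, for s the k-th largest of
    them; the shift bound applied to (H, K) and to (K, H) with this s produces
    exactly that quantity. *)
Lemma lidskii_abs (R : realType) n (H K U : 'M[R[i]]_n) l m V W d (f g : 'S_n) k :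
  spectral_form H l V -> spectral_form K m W ->
  U \is unitarymx -> H - K = U^t* *m rdiag_mx d *m U ->
  nonincreasing (fun i => `|d (g i)|) -> (k <= n)%N ->
  \sum_(i < n | (i < k)%N) `|l (f i) - m (f i)| <=
  \sum_(i < n | (i < k)%N) `|d (g i)|.
Proof.
move=> Hl Km Uu DE ddec; case: k => [|k] kn; first by rewrite !big_pred0.
(* k + 1 absolute eigenvalues are summed, and s is the smallest of them *)
pose s := `|d (g (Ordinal kn))|.
have [a [a0 la aE]] : exists a : 'I_n -> R, [/\ forall i, 0 <= a i,
    forall i, l i - m i <= s + a i & \sum_i a i = \sum_i Num.max (d i - s) 0].
  by apply: (eigenvalue_shift_bound s Hl Km Uu); rewrite -DE addrC subrK.
have [b [b0 mb bE]] : exists b : 'I_n -> R, [/\ forall i, 0 <= b i,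
    forall i, m i - l i <= s + b i & \sum_i b i = \sum_i Num.max (- d i - s) 0].
  apply: (eigenvalue_shift_bound s Km Hl Uu).
  rewrite (_ : rdiag_mx _ = - rdiag_mx d); last first.
    by apply/matrixP => i j; rewrite [RHS]mxE !rdiag_mxE rmorphN mulNrn.
  by rewrite mulmxN mulNmx -DE opprB addrC subrK.
have s0 : 0 <= s by exact: normr_ge0.
apply: (@le_trans _ _ (\sum_(i < n | (i < k.+1)%N) s + \sum_i (a i + b i))).
  rewrite [\sum_i (a i + b i)](reindex_inj (@perm_inj _ f)) /=.
  rewrite (bigID (fun i : 'I_n => (i < k.+1)%N) xpredT) /= addrA -big_split /=.
  apply: ler_wpDr; first by apply: sumr_ge0 => i _; rewrite addr_ge0.
  apply: ler_sum => i _; rewrite ler_norml.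
  by have := la (f i); have := mb (f i); have := a0 (f i); have := b0 (f i); lra.
(* max(d - s, 0) + max(- d - s, 0) is |d| - s at the first indices g i, 0 at the others *)
rewrite big_split aE bE /= -big_split /=.
rewrite [X in _ + X <= _](reindex_inj (@perm_inj _ g)) /=.
rewrite [X in _ + X <= _](bigID (fun i : 'I_n => (i < k.+1)%N) xpredT) /=.
rewrite [X in _ + (_ + X)]big1.
  rewrite addr0 -big_split /=; apply: ler_sum => i ik.
  have : s <= `|d (g i)| by exact: ddec.
  rewrite /Num.max /Order.max.
  by case: (ltrP (d _ - s) 0); case: (ltrP (- d _ - s) 0);
    case: (ger0P (d (g i))) => *; lra.
move=> i; rewrite -leqNgt => ki.
have : `|d (g i)| <= s by apply: ddec; exact: ltnW.
rewrite ler_norml => /andP[h1 h2].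
by rewrite !max_r ?addr0 //; lra.
Qed.

(** * Contractions and a trace form of the inequalities of Ky Fan and Horn *)

(** Encoded by the existence of a completion of B to an isometry: products are then
    handled by matrix algebra, without any operator norm. *)
Definition contraction (R : realType) m n (B : 'M[R[i]]_(m, n)) : Prop :=
  exists q (C : 'M[R[i]]_(q, n)), B^t* *m B + C^t* *m C = 1%:M.

Lemma contraction_isometry (R : realType) m n (B : 'M[R[i]]_(m, n)) :
  B^t* *m B = 1%:M -> contraction B.
Proof. by move=> BB; exists n, 0; rewrite BB mulmx0 addr0. Qed.

(** Covers partial isometries, for which the completion is the projection onto the
    kernel. *)
Lemma contraction_proj (R : realType) m n (B : 'M[R[i]]_(m, n)) :
  B *m (B^t* *m B) = B -> contraction B.
Proof.
move=> BBB; exists n, (1%:M - B^t* *m B).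
rewrite adjmxB adjmx1 adjmx_mul trmxCK mulmxBl mul1mx mulmxBr mulmx1.
by rewrite -mulmxA BBB subrr subr0 addrC subrK.
Qed.

Lemma contraction_adj_proj (R : realType) m n (B : 'M[R[i]]_(m, n)) :
  B *m (B^t* *m B) = B -> contraction (B^t*).
Proof.
move=> BBB; apply: contraction_proj; rewrite trmxCK.
by have := congr1 (fun X => X^t*) BBB; rewrite !adjmx_mul trmxCK mulmxA.
Qed.

Lemma contraction_mul (R : realType) m n p (A : 'M[R[i]]_(m, n)) (B : 'M[R[i]]_(n, p)) :
  contraction A -> contraction B -> contraction (A *m B).
Proof.
move=> [q [C AC]] [r [D BD]]; exists (q + r)%N, (col_mx (C *m B) D).
rewrite tr_col_mx map_row_mx mul_row_col !adjmx_mul addrA -BD; congr (_ + _).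
transitivity (B^t* *m (A^t* *m A + C^t* *m C) *m B); last by rewrite AC mulmx1.
by rewrite mulmxDr mulmxDl !mulmxA.
Qed.

Lemma adjmx_self_diagE (R : realType) m n (B : 'M[R[i]]_(m, n)) j :
  complex.Re ((B^t* *m B) j j) = \sum_i sqr_modulus (B i j).
Proof.
rewrite mxE Re_sum; apply: eq_bigr => i _.
by rewrite !mxE mulrC mul_conjE.
Qed.

Lemma contraction_diag_le1 (R : realType) n (B : 'M[R[i]]_n) i :
  contraction B -> complex.Re (B i i) <= 1.
Proof.
move=> [q [C /matrixP/(_ i i)/(congr1 (@complex.Re R))]].
rewrite mxE Re_add !adjmx_self_diagE mxE eqxx /= => BC1.
have : sqr_modulus (B i i) <= 1.
  rewrite -BC1 (bigD1 i) //= -addrA lerDl addr_ge0 // sumr_ge0 // => *;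
    exact: sqr_modulus_ge0.
rewrite /sqr_modulus; set x := complex.Re _; set y := complex.Im _ => xy.
by have := sqr_ge0 (x - 1); have := sqr_ge0 y; nra.
Qed.

(** A contraction of rank at most k, in the form of a factorization through a space
    of dimension k. *)
Definition rank_contraction (R : realType) m n k (W : 'M[R[i]]_(m, n)) : Prop :=
  exists (P : 'M[R[i]]_(m, k)) (Q : 'M[R[i]]_(k, n)),
    [/\ contraction P, contraction Q & W = P *m Q].

(** By Ky Fan duality this says that the k largest singular values of Z sum up to
    at most the sum of the first k of the z_i.  Stated by duality, it
    passes to products without computing their singular values. *)
Definition sv_dominated (R : realType) m n p (Z : 'M[R[i]]_(m, n)) (z : 'I_p -> R) : Prop :=
  forall k (W : 'M[R[i]]_(n, m)), (k <= p)%N -> rank_contraction k W ->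
  complex.Re (\tr (W *m Z)) <= \sum_(i < p | (i < k)%N) z i.

Lemma sv_dominated1 (R : realType) p :
  sv_dominated (1%:M : 'M[R[i]]_p) (fun _ : 'I_p => 1).
Proof.
move=> k W kp [P [Q [Pc Qc ->]]]; rewrite mulmx1 mxtrace_mulC.
rewrite -(big_ord_widen _ (fun _ => 1) kp) Re_sum; apply: ler_sum => i _.
exact/contraction_diag_le1/contraction_mul.
Qed.

Lemma sv_dominated_mulr (R : realType) m n q p (Z : 'M[R[i]]_(m, n))
    (C : 'M[R[i]]_(n, q)) (z : 'I_p -> R) :
  sv_dominated Z z -> contraction C -> sv_dominated (Z *m C) z.
Proof.
move=> Zz Cc k W kp [P [Q [Pc Qc ->]]].
rewrite mulmxA mxtrace_mulC !mulmxA; apply: Zz => //.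
by exists (C *m P), Q; split=> //; apply: contraction_mul.
Qed.

Lemma contraction_pid_mx (R : realType) m n k :
  (k <= m)%N -> contraction (pid_mx k : 'M[R[i]]_(m, n)).
Proof.
move=> km; apply: contraction_proj.
by rewrite tr_pid_mx map_pid_mx pid_mx_id // mul_pid_mx minnn pid_mx_minh.
Qed.

(** Horn's inequality for one diagonal factor.  Truncating the trace to the first j
    diagonal entries multiplies W by a projection of rank j, hence bounds its rank
    by min(j, k); summation by parts against s does the rest. *)
Lemma sv_dominated_rdiag (R : realType) m p (Z : 'M[R[i]]_(m, p)) (s z : 'I_p -> R) :
  sv_dominated Z z -> nonincreasing s -> (forall i, 0 <= s i) ->
  sv_dominated (Z *m rdiag_mx s) (fun i => z i * s i).
Proof.
move=> Zz sdec s0 k W kp [P [Q [Pc Qc WE]]].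
rewrite mulmxA /mxtrace Re_sum.
under eq_bigr do rewrite mul_mx_rdiagE mulrC Re_mul_real.
rewrite [leRHS]big_mkcond /=.
rewrite [leRHS](eq_bigr (fun i : 'I_p => s i * (if (i < k)%N then z i else 0))); last first.
  by move=> i _; case: ifP; rewrite ?mulr0 // mulrC.
apply: abel_sum_le => // j.
pose r := minn j k; have rp : (r <= p)%N by rewrite geq_min kp orbT.
have jp : (minn j p <= p)%N by rewrite geq_minr.
have : complex.Re (\tr (pid_mx (minn j p) *m W *m Z)) <= \sum_(i < p | (i < r)%N) z i.
  apply: Zz => //; rewrite /r; case: (leqP j k) => jk.
    rewrite (minn_idPl _) ?(leq_trans jk) //.
    exists (pid_mx j : 'M_(p, j)), ((pid_mx j : 'M_(j, p)) *m W); split.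
    - by apply: contraction_pid_mx; exact: leq_trans jk kp.
    - by rewrite WE; do ?apply: contraction_mul => //; exact: contraction_pid_mx.
    by rewrite mulmxA pid_mx_id.
  exists (pid_mx (minn j p) *m P), Q; split=> //; last by rewrite WE mulmxA.
  by apply: contraction_mul => //; exact: contraction_pid_mx.
have pidE : pid_mx (minn j p) = rdiag_mx (fun i : 'I_p => (i < j)%:R : R).
  apply/matrixP => a b; rewrite rdiag_mxE mxE leq_min ltn_ord andbT -val_eqE.
  by case: eqP => _; case: ltnP.
have -> : complex.Re (\tr (pid_mx (minn j p) *m W *m Z)) =
    \sum_(i < p | (i < j)%N) complex.Re ((W *m Z) i i).
  rewrite /mxtrace Re_sum [RHS]big_mkcond; apply: eq_bigr => i _.
  rewrite pidE -mulmxA mul_rdiag_mxE Re_mul_real.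
  by case: ifP; rewrite ?mul1r ?mul0r.
by under [leRHS]eq_bigl do rewrite /r leq_min; rewrite -big_mkcondr.
Qed.

(** Polar form of the singular value decomposition: P is B V^H times the inverse of
    the diagonal factor.  As the inverse of 0 is 0, P is a partial isometry even when
    some s_i vanish. *)
Lemma svd_factor (R : realType) m n (B : 'M[R[i]]_(m, n)) V s :
  V \is unitarymx -> B^t* *m B = V^t* *m rdiag_mx (fun i => s i ^+ 2) *m V ->
  exists P : 'M[R[i]]_(m, n), [/\ contraction P, contraction (P^t*),
    B = P *m rdiag_mx s *m V &
    (forall i, s i != 0) -> P^t* *m P = 1%:M].
Proof.
move=> Vu BB; pose P := B *m V^t* *m rdiag_mx (fun i => (s i)^-1).
have VBBV : V *m (B^t* *m B) *m V^t* = rdiag_mx (fun i => s i ^+ 2).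
  by rewrite BB !mulmxA (unitarymxP Vu) mul1mx mulmxtVK.
have PP : P^t* *m P = rdiag_mx (fun i => (s i != 0)%:R).
  rewrite /P !adjmx_mul trmxCK adj_rdiag_mx.
  transitivity (rdiag_mx (fun i => (s i)^-1) *m (V *m (B^t* *m B) *m V^t*) *m
                rdiag_mx (fun i => (s i)^-1)); first by rewrite !mulmxA.
  rewrite VBBV !rdiag_mxM; apply: eq_rdiag_mx => i.
  by have [->|s0] := eqVneq (s i) 0; [rewrite invr0 !mul0r | rewrite /=; field].
have PPP : P *m (P^t* *m P) = P.
  rewrite PP -mulmxA rdiag_mxM; congr (_ *m _); apply: eq_rdiag_mx => i.
  by have [->|s0] := eqVneq (s i) 0; rewrite ?mulr1 // invr0 mul0r.
exists P; split.
- exact: contraction_proj.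
- exact: contraction_adj_proj.
- rewrite -[LHS](mulmxKtV B Vu (erefl _)); congr (_ *m _).
  rewrite -[RHS]mulmxA rdiag_mxM; apply/matrixP => a j; rewrite mul_mx_rdiagE.
  have [s0|s0] := eqVneq (s j) 0; last by rewrite mulVf // mulr1.
  rewrite s0 mulr0 mulr0; have := adjmx_self_diagE (B *m V^t*) j.
  rewrite adjmx_mul trmxCK mulmxA -(mulmxA V) VBBV rdiag_mxE eqxx s0 expr0n /=.
  move/esym/eqP; rewrite psumr_eq0 => [|? _]; last exact: sqr_modulus_ge0.
  by move/allP/(_ a (mem_index_enum a)); rewrite sqr_modulus_eq0 => /eqP.
by move=> s0; rewrite PP -rdiag_mx1; apply: eq_rdiag_mx => i; rewrite s0.
Qed.

(** Signed sums of k diagonal entries in an orthonormal basis are traces against a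
    contraction of rank at most k. *)
Lemma rank_contraction_diag (R : realType) n (Q : 'M[R[i]]_n) (e : 'I_n -> R)
    (g : 'S_n) k :
  Q \is unitarymx -> (forall i, e i ^+ 2 = 1) -> (k <= n)%N ->
  exists2 W : 'M[R[i]]_n, rank_contraction k W &
    forall Z, complex.Re (\tr (W *m Z)) =
      \sum_(i < n | (i < k)%N) e (g i) * complex.Re ((Q *m Z *m Q^t*) (g i) (g i)).
Proof.
move=> Qu e1 kn.
pose f (i : 'I_k) := g (widen_ord kn i).
have finj : injective f by move=> i j /perm_inj /(congr1 val) /= /val_inj.
pose Q1 := rowsub f Q; have Q1Q1 : Q1 *m Q1^t* = 1%:M.
  apply/matrixP => i j; have /matrixP/(_ (f i) (f j)) := unitarymxP Qu.
  rewrite [RHS]mxE (inj_eq finj) => E; rewrite [RHS]mxE -E !mxE.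
  by apply: eq_bigr => l _; rewrite !mxE.
exists (Q1^t* *m rdiag_mx (e \o f) *m Q1).
  exists (Q1^t* *m rdiag_mx (e \o f)), Q1; split=> //.
    apply: contraction_mul; first by apply: contraction_isometry; rewrite trmxCK.
    apply: contraction_isometry; rewrite adj_rdiag_mx rdiag_mxM -rdiag_mx1.
    by apply: eq_rdiag_mx => i; rewrite -expr2 e1.
  rewrite -[Q1]trmxCK; apply: contraction_adj_proj.
  by rewrite trmxCK Q1Q1 mulmx1.
move=> Z; rewrite (big_ord_narrow kn) -!mulmxA mxtrace_mulC -!mulmxA /mxtrace Re_sum.
apply: eq_bigr => i _; rewrite mul_rdiag_mxE Re_mul_real; congr (_ * complex.Re _).
have -> : Q1^t* = colsub f (Q^t*) by apply/matrixP => a b; rewrite !mxE.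
by rewrite mulmx_colsub mul_rowsub_mx !mulmx_colsub !mxE.
Qed.

(** * Eigenvalues on the diagonal of a similar matrix *)

(** B is L^-1 d L.  Comparing the rows of L B and d L one after the other shows that
    B is lower triangular, and then gives its diagonal. *)
Lemma trig_intertwine_diag (F : fieldType) n (L B : 'M[F]_n) (d : 'rV[F]_n) :
  is_trig_mx L -> L \in unitmx -> L *m B = diag_mx d *m L ->
  forall i, B i i = d 0 i.
Proof.
move=> Lt Lu LB.
have L0 (i j : 'I_n) : (i < j)%N -> L i j = 0 by exact: (is_trig_mxP Lt).
have Lii i : L i i != 0.
  have : \det L != 0 by rewrite -unitfE -unitmxE.
  by rewrite det_trig // => /prodf_neq0; apply.
have LBE (i k : 'I_n) :
    (forall j : 'I_n, (j < i)%N -> B j k = 0) -> L i i * B i k = d 0 i * L i k.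
  move=> B0; have /matrixP/(_ i k) := LB; rewrite mul_diag_mx [RHS]mxE => <-.
  rewrite mxE (bigD1 i) //= big1 ?addr0 // => j; rewrite neq_ltn => /orP[ji|ij].
    by rewrite B0 ?mulr0.
  by rewrite L0 ?mul0r.
have B0 (i k : 'I_n) : (i < k)%N -> B i k = 0.
  elim: {i}_.+1 {-2}i (ltnSn i) => // m IHm i im ik.
  apply: (mulfI (Lii i)); rewrite mulr0 LBE ?L0 ?mulr0 // => j ji.
  by apply: IHm; [exact: leq_trans ji im | exact: ltn_trans ji ik].
by move=> i; apply: (mulfI (Lii i)); rewrite LBE 1?mulrC // => j; exact: B0.
Qed.

(** Row i of M lies in the span of the first i + 1 vectors of the orthonormal basis
    obtained from its rows. *)
Lemma schmidt_trig (C : numClosedFieldType) n (M : 'M[C]_n) :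
  is_trig_mx (M *m (schmidt M)^t*).
Proof.
have Qu : schmidt M \is unitarymx by exact: schmidt_unitarymx.
apply/is_trig_mxP => i j ij.
have : (row i M <= kermx ((row j (schmidt M))^t*))%MS.
  apply: submx_trans (row_schmidt_sub M i) _.
  apply/sumsmx_subP => k ki; rewrite genmxE; apply/sub_kermxP/rowP => a.
  have /row_unitarymxP/(_ k j) := Qu; rewrite dotmxE !ord1 mxE => ->.
  by rewrite -val_eqE /= (ltn_eqF (leq_ltn_trans ki ij)) mxE.
move/sub_kermxP/rowP/(_ 0); rewrite [RHS]mxE => <-; rewrite !mxE.
by apply: eq_bigr => k _; rewrite !mxE.
Qed.

(** If U N = L Q with L lower triangular, then N^-1 D N = Q^H L^-1 d L Q. *)
Lemma real_diag_of_similar (R : realType) n (N D U : 'M[R[i]]_n) d :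
  N \in unitmx -> U \is unitarymx -> D = U^t* *m rdiag_mx d *m U ->
  exists2 Q : 'M[R[i]]_n, Q \is unitarymx &
    forall i, (Q *m (invmx N *m D *m N) *m Q^t*) i i = (d i)%:C.
Proof.
move=> Nu Uu DE; pose Q := schmidt (U *m N); pose L := U *m N *m Q^t*.
have Qu : Q \is unitarymx by exact: schmidt_unitarymx.
exists Q => // i.
rewrite (@trig_intertwine_diag _ _ L _ (\row_i (d i)%:C)) ?mxE //.
- exact: schmidt_trig.
- by rewrite !unitmx_mul Nu (unitarymx_unit Uu) unitarymx_unit ?trmxC_unitary.
rewrite -/(rdiag_mx d) /L !mulmxA (mulmxKtV _ Qu (erefl _)) (mulmxK Nu) DE !mulmxA.
by rewrite (unitarymxP Uu) mul1mx.
Qed.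

(** * Comparison of Ritz values in bases diagonalizing the angles *)

(** The columns of (1 - Y Y^H) X are orthogonal, and their norms are the sines of the
    principal angles. *)
Lemma sines_gram (R : realType) n p (X Y : 'M[R[i]]_(n, p)) (tau : 'I_p -> R) :
  X^t* *m X = 1%:M -> Y^t* *m Y = 1%:M -> X^t* *m Y = rdiag_mx tau ->
  (X - Y *m (Y^t* *m X))^t* *m (X - Y *m (Y^t* *m X)) =
    rdiag_mx (fun i => 1 - tau i ^+ 2) /\ forall i, 0 <= 1 - tau i ^+ 2.
Proof.
move=> XX YY XY.
have YX : Y^t* *m X = rdiag_mx tau by rewrite -[LHS]trmxCK adjmx_mul trmxCK XY adj_rdiag_mx.
set C := X - _.
have CC : C^t* *m C = rdiag_mx (fun i => 1 - tau i ^+ 2).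
  rewrite /C YX adjmxB adjmx_mul adj_rdiag_mx; set T := rdiag_mx tau.
  rewrite mulmxBl !mulmxBr !mulmxA -[T *m Y^t* *m X]mulmxA -[T *m Y^t* *m Y]mulmxA.
  rewrite XX XY YX YY mulmx1 subrr subr0 rdiag_mxM.
  apply/matrixP => i j; rewrite !mxE.
  by case: eqVneq => [->|]; rewrite ?subrr // !mulr1n rmorphB rmorph1.
split=> // i; have := adjmx_self_diagE C i; rewrite CC rdiag_mxE eqxx /= => ->.
by rewrite sumr_ge0 // => j _; exact: sqr_modulus_ge0.
Qed.

(** Since Y^H B = 0 for a residual B, X^H B equals ((1 - Y Y^H) X)^H Pi B, which brings
    in the sines; the two outer factors together contribute 1 / tau. *)
Lemma scaled_residual_dominated (R : realType) n p (X Y B : 'M[R[i]]_(n, p))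
    (Pi : 'M[R[i]]_n) (V : 'M[R[i]]_p) (tau s : 'I_p -> R) :
  X^t* *m X = 1%:M -> Y^t* *m Y = 1%:M -> X^t* *m Y = rdiag_mx tau ->
  (forall i, 0 < tau i) -> (forall i j : 'I_p, (i <= j)%N -> tau i <= tau j) ->
  X^t* *m Pi = X^t* -> Y^t* *m Pi = Y^t* -> Y^t* *m B = 0 ->
  V \is unitarymx ->
  (Pi *m B)^t* *m (Pi *m B) = V^t* *m rdiag_mx (fun i => s i ^+ 2) *m V ->
  nonincreasing s -> (forall i, 0 <= s i) ->
  let Ni := rdiag_mx (fun i => (Num.sqrt (tau i))^-1) in
  sv_dominated (Ni *m (X^t* *m B) *m Ni)
    (fun i => s i * (Num.sqrt (1 - tau i ^+ 2) / tau i)).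
Proof.
move=> XX YY XY tau0 tauI XPi YPi YB Vu BB sdec s0 Ni.
have YX : Y^t* *m X = rdiag_mx tau by rewrite -[LHS]trmxCK adjmx_mul trmxCK XY adj_rdiag_mx.
have [CC tau1] := sines_gram XX YY XY.
pose C := X - Y *m (Y^t* *m X); rewrite -/C in CC.
have CE : C^t* = X^t* - rdiag_mx tau *m Y^t* by rewrite /C YX adjmxB adjmx_mul adj_rdiag_mx.
pose sn i := Num.sqrt (1 - tau i ^+ 2).
have [P1 [_ P1c CF _]] : exists P : 'M[R[i]]_(n, p),
    [/\ contraction P, contraction (P^t*), C = P *m rdiag_mx sn *m 1%:M &
    (forall i, sn i != 0) -> P^t* *m P = 1%:M].
  apply: svd_factor; first by apply/unitarymxP; rewrite adjmx1 mulmx1.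
  rewrite CC adjmx1 mulmx1 mul1mx; apply: eq_rdiag_mx => i.
  by rewrite /sn sqr_sqrtr.
have [P2 [P2c _ BF _]] := svd_factor Vu BB.
have XB : X^t* *m B = rdiag_mx sn *m P1^t* *m P2 *m rdiag_mx s *m V.
  transitivity (C^t* *m (Pi *m B)).
    by rewrite CE mulmxBl -mulmxA !(mulmxA _ Pi) XPi YPi YB mulmx0 subr0.
  rewrite mulmx1 in CF.
  by rewrite CF BF (adjmx_mul P1) adj_rdiag_mx !mulmxA.
have st i : 0 < Num.sqrt (tau i) by rewrite sqrtr_gt0.
have tdec : nonincreasing (fun i => (Num.sqrt (tau i))^-1).
  by move=> i j ij; rewrite lef_pV2 ?posrE // ler_wsqrtr // tauI.
have t0 i : 0 <= (Num.sqrt (tau i))^-1 by rewrite invr_ge0 ltW.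
have sndec : nonincreasing sn.
  move=> i j ij; rewrite ler_wsqrtr // lerD2l lerN2.
  by rewrite ler_pXn2r ?nnegrE ?(ltW (tau0 _)) ?tauI.
move=> k W kp Wk.
have := sv_dominated_rdiag (sv_dominated_mulr (sv_dominated_rdiag (sv_dominated_mulr
  (sv_dominated_mulr (sv_dominated_rdiag (sv_dominated_rdiag (@sv_dominated1 R p)
  tdec t0) sndec _) P1c) P2c) sdec s0) (contraction_isometry (unitarymx_tK Vu))) tdec t0.
move=> /(_ (fun i => sqrtr_ge0 _) _ _ kp Wk); rewrite XB mul1mx !mulmxA => /le_trans; apply.
apply: ler_sum => i _; rewrite -/(sn i) le_eqVlt; apply/orP; left; apply/eqP.
rewrite -[in RHS](sqr_sqrtr (ltW (tau0 i))); have := lt0r_neq0 (st i).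
by move: (Num.sqrt (tau i)) => r r0; field.
Qed.

(** The bound by tangents, when X^H Y is already diagonal with entries tau, the cosines
    in nondecreasing order. *)
Lemma rotated_ritz_bound (R : realType) n p (A Pi : 'M[R[i]]_n) (X Y : 'M[R[i]]_(n, p))
    (V W Vx Vy : 'M[R[i]]_p) (tau l m sx sy : 'I_p -> R) (f : 'S_p) k :
  A^t* = A -> X^t* *m X = 1%:M -> Y^t* *m Y = 1%:M -> X^t* *m Y = rdiag_mx tau ->
  (forall i, 0 < tau i) -> (forall i j : 'I_p, (i <= j)%N -> tau i <= tau j) ->
  X^t* *m Pi = X^t* -> Y^t* *m Pi = Y^t* ->
  spectral_form (X^t* *m A *m X) l V -> spectral_form (Y^t* *m A *m Y) m W ->
  Vx \is unitarymx -> Vy \is unitarymx ->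
  (Pi *m residual A X)^t* *m (Pi *m residual A X) =
    Vx^t* *m rdiag_mx (fun i => sx i ^+ 2) *m Vx ->
  (Pi *m residual A Y)^t* *m (Pi *m residual A Y) =
    Vy^t* *m rdiag_mx (fun i => sy i ^+ 2) *m Vy ->
  nonincreasing sx -> (forall i, 0 <= sx i) ->
  nonincreasing sy -> (forall i, 0 <= sy i) -> (k <= p)%N ->
  \sum_(i < p | (i < k)%N) `|l (f i) - m (f i)| <=
  \sum_(i < p | (i < k)%N) (sx i + sy i) * (Num.sqrt (1 - tau i ^+ 2) / tau i).
Proof.
move=> Ah XX YY XY tau0 tauI XPi YPi Hl Km Vxu Vyu RXE RYE sxdec sx0 sydec sy0 kp.
set H := X^t* *m A *m X in Hl; set K := Y^t* *m A *m Y in Km.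
have Hh : H^t* = H by rewrite /H !adjmx_mul trmxCK Ah mulmxA.
have Kh : K^t* = K by rewrite /K !adjmx_mul trmxCK Ah mulmxA.
have HE : X^t* *m A *m X = H by [].
have KE : Y^t* *m A *m Y = K by [].
clearbody H K.
have YX : Y^t* *m X = rdiag_mx tau by rewrite -[LHS]trmxCK adjmx_mul trmxCK XY adj_rdiag_mx.
have resX : X^t* *m residual A X = 0.
  by rewrite /residual mulmxBr mulmxA (mulmxA _ X) XX mul1mx subrr.
have resY : Y^t* *m residual A Y = 0.
  by rewrite /residual mulmxBr mulmxA (mulmxA _ Y) YY mul1mx subrr.
have st i : 0 < Num.sqrt (tau i) by rewrite sqrtr_gt0.
pose N : 'M[R[i]]_p := rdiag_mx (fun i => Num.sqrt (tau i)).
pose Ni : 'M[R[i]]_p := rdiag_mx (fun i => (Num.sqrt (tau i))^-1).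
have NNi : N *m Ni = 1%:M.
  rewrite rdiag_mxM -rdiag_mx1; apply: eq_rdiag_mx => i.
  by rewrite divff ?gt_eqF.
have [Nu _] := mulmx1_unit NNi.
have NiE : invmx N = Ni by rewrite -[RHS](mulKmx Nu) NNi mulmx1.
have NN : rdiag_mx tau = N *m N.
  by rewrite rdiag_mxM; apply: eq_rdiag_mx => i; rewrite -expr2 sqr_sqrtr // ltW.
have NiN : Ni *m N = 1%:M by rewrite -NiE mulVmx.
have NtE : N^t* = N by rewrite adj_rdiag_mx.
have NitE : Ni^t* = Ni by rewrite adj_rdiag_mx.
have [U Dd] : exists U, spectral_form (H - K) (eigvals (H - K) 0) U.
  by apply: hermitian_spectral_form; rewrite adjmxB Hh Kh.
have [Uu DE _] := Dd; set d := eigvals (H - K) 0 in DE.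
have [Q Qu Qd] := real_diag_of_similar Nu Uu DE.
have [g gdec _] := decr_perm (fun i => `|d i|).
apply: le_trans (lidskii_abs f Hl Km Uu DE gdec kp) _.
pose Z1 := Ni *m (X^t* *m residual A Y) *m Ni.
pose Z2 := Ni *m (Y^t* *m residual A X) *m Ni.
pose rho i M := complex.Re ((Q *m M *m Q^t*) i i).
have rhoB i M1 M2 : rho i (M1 - M2) = rho i M1 - rho i M2.
  by rewrite /rho mulmxBr mulmxBl [in LHS]mxE [in X in _ + X]mxE Re_add Re_opp.
have rhoA i M : rho i (M^t*) = rho i M.
  rewrite /rho; have -> : Q *m M^t* *m Q^t* = (Q *m M *m Q^t*)^t*.
    by rewrite !adjmx_mul trmxCK mulmxA.
  by move: (Q *m M *m Q^t*) => B; rewrite !mxE Re_conj.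
(* Both sides equal N^-1 (H T - T K) N^-1, as T = N N. *)
have ZE : Z1 - Z2^t* = Ni *m H *m N - N *m K *m Ni.
  have EE : X^t* *m residual A Y - (Y^t* *m residual A X)^t* =
      H *m rdiag_mx tau - rdiag_mx tau *m K.
    rewrite adjmx_mul trmxCK /residual HE KE adjmxB (adjmx_mul A X) (adjmx_mul X H) Hh Ah.
    rewrite mulmxBl mulmxBr.
    rewrite !mulmxA -[H *m X^t* *m Y]mulmxA XY.
    by rewrite opprB addrC addrA subrK.
  have -> : Z2^t* = Ni *m (Y^t* *m residual A X)^t* *m Ni.
    by rewrite /Z2 adjmx_mul NitE adjmx_mul NitE mulmxA.
  rewrite /Z1 -mulmxBl -mulmxBr EE NN mulmxBr mulmxBl.
  rewrite -!mulmxA NNi mulmx1; congr (_ - _).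
  by rewrite !mulmxA NiN mul1mx.
have dE i : d i = rho i Z1 - rho i Z2.
  have -> : d i = rho i (Ni *m H *m N) - rho i (Ni *m K *m N).
    by rewrite -rhoB -mulmxBl -mulmxBr /rho -NiE Qd.
  (* these two matrices are adjoint to each other *)
  have -> : rho i (Ni *m K *m N) = rho i (N *m K *m Ni).
    by rewrite -[LHS]rhoA !adjmx_mul NtE NitE Kh mulmxA.
  by rewrite -rhoB -ZE rhoB; congr (_ - _); exact: rhoA.
pose e i : R := if 0 <= d i then 1 else -1.
have e1 i : e i ^+ 2 = 1 by rewrite /e; case: ifP; rewrite ?sqrrN expr1n.
have dabs i : `|d i| = e i * rho i Z1 + - e i * rho i Z2.
  rewrite mulNr -mulrBr -dE /e; case: (ger0P (d i)) => _; first by rewrite mul1r.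
  by rewrite mulN1r.
have [W1 W1k W1E] := rank_contraction_diag g Qu e1 kp.
have e1N i : (- e i) ^+ 2 = 1 by rewrite sqrrN e1.
have [W2 W2k W2E] := rank_contraction_diag g Qu e1N kp.
have S1 : complex.Re (\tr (W1 *m Z1)) =
  \sum_(i < p | (i < k)%N) e (g i) * rho (g i) Z1 := W1E Z1.
have S2 : complex.Re (\tr (W2 *m Z2)) =
  \sum_(i < p | (i < k)%N) - e (g i) * rho (g i) Z2 := W2E Z2.
have X1 := scaled_residual_dominated YY XX YX tau0 tauI YPi XPi resX
  Vxu RXE sxdec sx0 kp W2k.
have Y1 := scaled_residual_dominated XX YY XY tau0 tauI XPi YPi resY
  Vyu RYE sydec sy0 kp W1k.
apply: (@le_trans _ _ (complex.Re (\tr (W2 *m Z2)) + complex.Re (\tr (W1 *m Z1)))).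
  rewrite (eq_bigr _ (fun i _ => dabs (g i))) big_split /= addrC.
  by apply: lerD; [rewrite S2 | rewrite S1].
apply: le_trans (lerD X1 Y1) _; rewrite -big_split /=.
by apply: ler_sum => i _; rewrite mulrDl.
Qed.

(** * Singular values, projections and residuals in arbitrary bases *)

(** The eigenvalues of the Gram matrix are the squared column norms of B V^H, hence
    nonnegative, so that squaring the singular values gives them back. *)
Lemma singvals_gram (R : realType) m n (B : 'M[R[i]]_(m, n)) :
  exists V : 'M[R[i]]_n, [/\ V \is unitarymx,
    B^t* *m B = V^t* *m rdiag_mx (fun i => singvals B 0 i ^+ 2) *m V,
    nonincreasing (singvals B 0) & forall i, 0 <= singvals B 0 i].
Proof.
have Bh : (B^t* *m B)^t* = B^t* *m B by rewrite adjmx_mul trmxCK.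
have [V [Vu BE ldec]] := hermitian_spectral_form Bh.
have VBV : (B *m V^t*)^t* *m (B *m V^t*) = rdiag_mx (eigvals (B^t* *m B) 0).
  rewrite adjmx_mul trmxCK mulmxA -(mulmxA V) {1}BE !mulmxA (unitarymxP Vu) mul1mx.
  by rewrite mulmxtVK.
have l0 i : 0 <= eigvals (B^t* *m B) 0 i.
  have := adjmx_self_diagE (B *m V^t*) i; rewrite VBV rdiag_mxE eqxx /= => ->.
  by rewrite sumr_ge0 // => j _; exact: sqr_modulus_ge0.
exists V; split; first exact: Vu.
- rewrite {1}BE; congr (_ *m _ *m _); apply: eq_rdiag_mx => i.
  by rewrite [singvals B 0 i]mxE sqr_sqrtr.
- move=> i j ij; rewrite [leLHS]mxE [leRHS]mxE.
  exact: ler_wsqrtr (ldec i j ij).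
by move=> i; rewrite mxE; exact: sqrtr_ge0.
Qed.

Lemma singvals0 (R : realType) m n i : singvals (0 : 'M[R[i]]_(m, n)) 0 i = 0.
Proof.
rewrite mxE mulmx0 (@spectral_form_eigvals _ _ _ (fun => 0) 1%:M) ?sqrtr0 //.
split=> [||i' j' _]; last exact: lexx.
  by apply/unitarymxP; rewrite adjmx1 mulmx1.
rewrite adjmx1 mulmx1 mul1mx; apply/matrixP => a b.
by rewrite rdiag_mxE mxE mul0rn.
Qed.

(** The rows of 1 - proj_ortho are orthogonal to the row space that it projects onto. *)
Lemma adj_mul_proj_sum (R : realType) n p (X Y Z : 'M[R[i]]_(n, p)) :
  (Z^T <= X^T + Y^T)%MS -> Z^t* *m proj_sum X Y = Z^t*.
Proof.
rewrite -submx_ortho => ZS.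
have /orthomx1P := submx_trans (proj_ortho_compl_sub (X^T + Y^T)%MS 1%:M) ZS.
rewrite mul1mx trmxK mulmxBl mul1mx => /subr0_eq ZE.
by rewrite -map_trmx /proj_sum -trmx_mul -ZE.
Qed.

Lemma residual_mul_unitary (R : realType) n p (A : 'M[R[i]]_n) (X : 'M[R[i]]_(n, p))
    (Q : 'M[R[i]]_p) :
  Q \is unitarymx -> residual A (X *m Q) = residual A X *m Q.
Proof.
move=> Qu; rewrite /residual adjmx_mul mulmxBl !mulmxA; congr (_ - _).
by rewrite mulmxtVK.
Qed.

Lemma gram_mul_unitary (R : realType) m n (B : 'M[R[i]]_(m, n)) (V Q : 'M[R[i]]_n) s :
  B^t* *m B = V^t* *m rdiag_mx s *m V ->
  (B *m Q)^t* *m (B *m Q) = (V *m Q)^t* *m rdiag_mx s *m (V *m Q).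
Proof.
move=> BB; transitivity (Q^t* *m (B^t* *m B) *m Q).
  by rewrite adjmx_mul !mulmxA.
by rewrite BB adjmx_mul !mulmxA.
Qed.

(** * The bound by tangents and its three consequences *)

Lemma acos_lt_pihalf_gt0 (R : realType) (x : R) : 0 <= x -> acos x < pi / 2 -> 0 < x.
Proof. by rewrite le_eqVlt => /predU1P[<-|//]; rewrite acos0 ltxx. Qed.

(** Bases are rotated by the factors of a singular value decomposition of X^H Y.  It is
    taken with increasing singular values, so that tau lists the cosines of the angles
    in the order of the angles. *)
Lemma ritz_partial_sum_le (R : realType) n p (A : 'M[R[i]]_n) (X Y : 'M[R[i]]_(n, p)) :
  A \is hermsymmx -> X^t* *m X = 1%:M -> Y^t* *m Y = 1%:M ->
  (forall i : 'I_p, angles X Y 0 i < pi / 2) ->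
  exists tau : 'I_p -> R, [/\ forall i, angles X Y 0 i = acos (tau i),
    forall i, 0 < tau i <= 1, forall i j : 'I_p, (i <= j)%N -> tau i <= tau j &
    forall (f : 'S_p) k, (k <= p)%N ->
    \sum_(i < p | (i < k)%N)
      `|eigvals (X^t* *m A *m X) 0 (f i) - eigvals (Y^t* *m A *m Y) 0 (f i)| <=
    \sum_(i < p | (i < k)%N)
      (singvals (proj_sum X Y *m residual A X) 0 i +
       singvals (proj_sum X Y *m residual A Y) 0 i) *
      (Num.sqrt (1 - tau i ^+ 2) / tau i)].
Proof.
rewrite hermsymmxE => /eqP Ah XX YY XYlt.
have [V [Vu ME sdec s0]] := singvals_gram (X^t* *m Y).
pose g : 'S_p := perm (@rev_ord_inj p).
pose tau i := singvals (X^t* *m Y) 0 (g i).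
have angE i : angles X Y 0 i = acos (tau i) by rewrite mxE /tau permE.
have tau0 i : 0 < tau i by apply: acos_lt_pihalf_gt0; rewrite ?s0 // -angE.
have tauI (i j : 'I_p) : (i <= j)%N -> tau i <= tau j.
  by move=> ij; apply: sdec; rewrite !permE /= leq_sub2l.
pose V' := row_perm g V; have V'u : V' \is unitarymx by exact: unitary_row_perm.
have ME' : (X^t* *m Y)^t* *m (X^t* *m Y) = V'^t* *m rdiag_mx (fun i => tau i ^+ 2) *m V'.
  by rewrite ME -(unitary_rdiag_row_perm _ _ g).
have [P [_ _ MP PP]] := svd_factor V'u ME'.
have {}PP : P^t* *m P = 1%:M by apply: PP => i; rewrite gt_eqF.
have Pu : P \is unitarymx by rewrite -trmxC_unitary; apply/unitarymxP; rewrite trmxCK.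
have Qu : V'^t* \is unitarymx by rewrite trmxC_unitary.
have XX' : (X *m P)^t* *m (X *m P) = 1%:M.
  transitivity (P^t* *m (X^t* *m X) *m P); first by rewrite adjmx_mul !mulmxA.
  by rewrite XX mulmx1.
have YY' : (Y *m V'^t*)^t* *m (Y *m V'^t*) = 1%:M.
  transitivity (V' *m (Y^t* *m Y) *m V'^t*); first by rewrite adjmx_mul trmxCK !mulmxA.
  by rewrite YY mulmx1 (unitarymxP V'u).
have XY' : (X *m P)^t* *m (Y *m V'^t*) = rdiag_mx tau.
  transitivity (P^t* *m (X^t* *m Y) *m V'^t*); first by rewrite adjmx_mul !mulmxA.
  by rewrite MP !mulmxA PP mul1mx (mulmxtVK _ V'u).
have herm (Z : 'M[R[i]]_(n, p)) : (Z^t* *m A *m Z)^t* = Z^t* *m A *m Z.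
  by rewrite !adjmx_mul trmxCK Ah mulmxA.
have conjE (Z : 'M[R[i]]_(n, p)) (Q : 'M[R[i]]_p) :
    (Z *m Q)^t* *m A *m (Z *m Q) = Q^t* *m (Z^t* *m A *m Z) *m Q.
  by rewrite adjmx_mul !mulmxA.
have [U1 H1] := hermitian_spectral_form (herm X).
have [U2 H2] := hermitian_spectral_form (herm Y).
have {}H1 := spectral_form_mul_unitary H1 Pu; rewrite -conjE in H1.
have {}H2 := spectral_form_mul_unitary H2 Qu; rewrite -conjE in H2.
have PiX : X^t* *m proj_sum X Y = X^t* by apply: adj_mul_proj_sum; exact: addsmxSl.
have PiY : Y^t* *m proj_sum X Y = Y^t* by apply: adj_mul_proj_sum; exact: addsmxSr.
have PiX' : (X *m P)^t* *m proj_sum X Y = (X *m P)^t*.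
  by rewrite adjmx_mul -mulmxA PiX.
have PiY' : (Y *m V'^t*)^t* *m proj_sum X Y = (Y *m V'^t*)^t*.
  by rewrite adjmx_mul -mulmxA PiY.
have [Vx [Vxu Gx sxdec sx0]] := singvals_gram (proj_sum X Y *m residual A X).
have [Vy [Vyu Gy sydec sy0]] := singvals_gram (proj_sum X Y *m residual A Y).
have Gx' := gram_mul_unitary P Gx; have Gy' := gram_mul_unitary (V'^t*) Gy.
rewrite -(mulmxA _ _ P) -(residual_mul_unitary _ _ Pu) in Gx'.
rewrite -(mulmxA _ _ (V'^t*)) -(residual_mul_unitary _ _ Qu) in Gy'.
exists tau; split=> [//|i|//|f k kp].
  have [_ /(_ i)] := sines_gram XX' YY' XY'.
  by rewrite tau0 subr_ge0 expr_le1 // ltW.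
exact: (rotated_ritz_bound f Ah XX' YY' XY' tau0 tauI PiX' PiY' H1 H2 (mul_unitarymx Vxu Pu)
  (mul_unitarymx Vyu Qu) Gx' Gy' sxdec sx0 sydec sy0 kp).
Qed.

(** The entries s_i tan(th_i) are at most those of the first and third right-hand
    sides, and the second bound is the square of the one by s_i tan(th_i). *)
Lemma wmajorized_three_bounds (R : realType) p (x s th tau : 'I_p -> R) (tmin tmax : R) :
  (forall i, th i = acos (tau i)) -> (forall i, 0 < tau i <= 1) ->
  (forall i j : 'I_p, (i <= j)%N -> tau i <= tau j) ->
  nonincreasing s -> (forall i, 0 <= s i) -> (forall i, 0 <= x i) ->
  tmax < pi / 2 -> (forall i, th i <= tmax) ->
  0 <= tmin -> (forall i, tmin <= th i) ->
  (forall (f : 'S_p) k, (k <= p)%N ->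
    \sum_(i < p | (i < k)%N) x (f i) <=
    \sum_(i < p | (i < k)%N) s i * (Num.sqrt (1 - tau i ^+ 2) / tau i)) ->
  [/\ \row_i x i <w \row_i (s i * (sin (th i) / cos tmax)),
      \row_i x i ^+ 2 <w \row_i (s i ^+ 2 * tan (th i) ^+ 2) &
      \row_i x i <w \row_i (Num.sqrt (cos tmin / cos tmax) * s i * tan (th i))].
Proof.
move=> thE tau01 tauI sdec s0 x0 tmax_lt th_le tmin0 le_th bound.
have tau0 i : 0 < tau i by case/andP: (tau01 i).
have tau11 i : -1 <= tau i <= 1.
  by case/andP: (tau01 i) => t0 ->; rewrite andbT (le_trans _ (ltW t0)) // lerN10.
have cosE i : cos (th i) = tau i by rewrite thE acosK // in_itv; exact: tau11.
have sinE i : sin (th i) = Num.sqrt (1 - tau i ^+ 2) by rewrite thE sin_acos.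
have tanE i : tan (th i) = Num.sqrt (1 - tau i ^+ 2) / tau i by rewrite /tan sinE cosE.
have sin0 i : 0 <= sin (th i) by rewrite sinE sqrtr_ge0.
have tan0 i : 0 <= tan (th i) by rewrite tanE divr_ge0 ?sqrtr_ge0 // ltW.
have sindec : nonincreasing (fun i => sin (th i)).
  move=> i j ij; rewrite !sinE ler_wsqrtr // lerD2l lerN2.
  by rewrite ler_pXn2r ?nnegrE ?(ltW (tau0 _)) ?tauI.
have tandec : nonincreasing (fun i => tan (th i)).
  move=> i j ij; rewrite !tanE -!sinE ler_pM ?invr_ge0 ?(ltW (tau0 _)) ?sindec //.
  by rewrite lef_pV2 ?posrE ?tau0 ?tauI.
have mulD (a b : 'I_p -> R) : nonincreasing a -> nonincreasing b ->
    (forall i, 0 <= a i) -> (forall i, 0 <= b i) -> nonincreasing (fun i => a i * b i).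
  by move=> ad bd a0 b0 i j ij; apply: ler_pM; rewrite ?a0 ?b0 //; [exact: ad | exact: bd].
have y0 i : 0 <= s i * tan (th i) by rewrite mulr_ge0.
have {}bound (f : 'S_p) k : (k <= p)%N -> \sum_(i < p | (i < k)%N) x (f i) <=
    \sum_(i < p | (i < k)%N) s i * tan (th i).
  by move=> kp; under [leRHS]eq_bigr do rewrite tanE; exact: bound.
have th0 i : 0 <= th i by apply: le_trans (le_th i).
have pi0 : 0 < pi :> R by exact: pi_gt0.
have in0pi t : 0 <= t -> t <= tmax -> t \in `[0, pi].
  by move=> t0 tt; rewrite in_itv /= t0; lra.
have cosmax (i : 'I_p) : 0 < cos tmax.
  by apply: cos_gt0_pihalf; have := th0 i; have := th_le i; lra.
have cosmax_le i : cos tmax <= tau i.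
  have tmax0 : 0 <= tmax := le_trans (th0 i) (th_le i).
  by rewrite -cosE leNgt ltr_cos ?in0pi // -leNgt.
have cosmin_ge i : tau i <= cos tmin.
  by rewrite -cosE leNgt ltr_cos ?in0pi // -?leNgt // (le_trans (le_th i)).
split.
- apply: wmajorizedP => [|f k _ kp].
    apply: mulD => // [i j ij|i]; last by rewrite divr_ge0 // ltW // (cosmax i).
    by rewrite ler_wpM2r ?sindec // invr_ge0 ltW // (cosmax i).
  apply: le_trans (bound f k kp) _; apply: ler_sum => i _.
  rewrite ler_wpM2l // tanE -sinE ler_wpM2l // lef_pV2 ?posrE //.
  exact: (cosmax i).
- apply: wmajorizedP => [|f k fdec kp].
    apply: mulD => [i j ij|i j ij|i|i]; rewrite ?sqr_ge0 //.
      by rewrite ler_pXn2r ?nnegrE ?sdec.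
    by rewrite ler_pXn2r ?nnegrE ?tandec.
  under [leRHS]eq_bigr do rewrite -exprMn.
  apply: (@partial_sum_sqr_le _ _ (x \o f)) => // [i j ij|||k'] /=.
  + by have := fdec i j ij; rewrite /= ler_pXn2r ?nnegrE.
  + exact: mulD.
  + by move=> i; exact: x0.
  (* beyond p the index condition is void, as it is for k' = p *)
  have [kp'|pk] := leqP k' p; first exact: bound.
  have all_lt (i : 'I_p) : (i < k')%N = (i < p)%N by rewrite ltn_ord (ltn_trans _ pk).
  by rewrite !(eq_bigl _ _ all_lt); exact: bound.
apply: wmajorizedP => [|f k _ kp].
  apply: mulD => // [i j ij|i]; last by rewrite mulr_ge0 // sqrtr_ge0.
  by rewrite ler_wpM2l ?sqrtr_ge0 ?sdec.
apply: le_trans (bound f k kp) _; apply: ler_sum => i _.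
rewrite -mulrA ler_peMl // -sqrtr1 ler_wsqrtr // ler_pdivlMr ?(cosmax i) // mul1r.
exact: le_trans (cosmax_le i) (cosmin_ge i).
Qed.

Lemma residual_invariant (R : realType) n p (A : 'M[R[i]]_n) (X : 'M[R[i]]_(n, p)) :
  X^t* *m X = 1%:M -> invariant_colspace A X -> residual A X = 0.
Proof.
move=> XX /submxP[D /(congr1 trmx)]; rewrite !trmx_mul !trmxK => AX.
by rewrite /residual -(mulmxA (X^t*)) AX (mulmxA (X^t*)) XX mul1mx subrr.
Qed.

Unset Implicit Arguments.

Theorem corollary4p4 (R : realType) (n p : nat)
    (A : 'M[R[i]]_n) (X Y : 'M[R[i]]_(n, p))
    (hA : A \is hermsymmx)
    (hX : X^t* *m X = 1%:M) (hY : Y^t* *m Y = 1%:M)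
    (hXY : forall i : 'I_p, angles X Y 0 i < pi / 2) :
  let c := cos (theta_min X Y) / cos (theta_max X Y) in
  let LX := eigvals (X^t* *m A *m X) in
  let LY := eigvals (Y^t* *m A *m Y) in
  let SX := singvals (proj_sum X Y *m residual A X) in
  let SY := singvals (proj_sum X Y *m residual A Y) in
  let Theta := angles X Y in
  [/\ \row_i `|LX 0 i - LY 0 i| <w
        \row_i ((SX 0 i + SY 0 i) *
                (sin (Theta 0 i) / cos (theta_max X Y))),
      \row_i `|LX 0 i - LY 0 i| ^+ 2 <w
        \row_i ((SX 0 i + SY 0 i) ^+ 2 * tan (Theta 0 i) ^+ 2) &
      \row_i `|LX 0 i - LY 0 i| <w
        \row_i (Num.sqrt c * (SX 0 i + SY 0 i) * tan (Theta 0 i))] /\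
  (invariant_colspace A X ->
   [/\ \row_i `|LX 0 i - LY 0 i| <w
         \row_i (SY 0 i * (sin (Theta 0 i) / cos (theta_max X Y))),
       \row_i `|LX 0 i - LY 0 i| ^+ 2 <w
         \row_i (SY 0 i ^+ 2 * tan (Theta 0 i) ^+ 2) &
       \row_i `|LX 0 i - LY 0 i| <w
         \row_i (Num.sqrt c * SY 0 i * tan (Theta 0 i))]).
Proof.
move=> c LX LY SX SY Theta.
have [tau [thE tau01 tauI bound]] := ritz_partial_sum_le hA hX hY hXY.
have [_ [_ _ sxdec sx0]] := singvals_gram (proj_sum X Y *m residual A X).
have [_ [_ _ sydec sy0]] := singvals_gram (proj_sum X Y *m residual A Y).
rewrite -/SX in sxdec sx0; rewrite -/SY in sydec sy0.
have {}bound (f : 'S_p) k : (k <= p)%N ->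
    \sum_(i < p | (i < k)%N) `|LX 0 (f i) - LY 0 (f i)| <=
    \sum_(i < p | (i < k)%N)
      (SX 0 i + SY 0 i) * (Num.sqrt (1 - tau i ^+ 2) / tau i) by exact: bound.
have pi0 : 0 < pi :> R by exact: pi_gt0.
have th_ge0 i : 0 <= Theta 0 i.
  rewrite thE acos_ge0 //; case/andP: (tau01 i) => t0 ->.
  by rewrite andbT (le_trans _ (ltW t0)) // lerN10.
have tmax_lt : theta_max X Y < pi / 2 by apply: bigmax_lt => // *; lra.
have th_le i : Theta 0 i <= theta_max X Y by exact: le_bigmax.
have tmin0 : 0 <= theta_min X Y by apply: le_bigmin => // *; lra.
have le_th i : theta_min X Y <= Theta 0 i by exact: bigmin_le.
have main s : nonincreasing s -> (forall i, 0 <= s i) ->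
    (forall (f : 'S_p) k, (k <= p)%N ->
      \sum_(i < p | (i < k)%N) `|LX 0 (f i) - LY 0 (f i)| <=
      \sum_(i < p | (i < k)%N) s i * (Num.sqrt (1 - tau i ^+ 2) / tau i)) -> _ :=
  fun sdec s0 sb => wmajorized_three_bounds thE tau01 tauI sdec s0
    (fun i => normr_ge0 (LX 0 i - LY 0 i)) tmax_lt th_le tmin0 le_th sb.
split=> [|Xinv].
  apply: (main (fun i => SX 0 i + SY 0 i)) => [i j ij|i|].
  - by apply: lerD; [exact: sxdec | exact: sydec].
  - exact: addr_ge0 (sx0 i) (sy0 i).
  exact: bound.
have SX0 i : SX 0 i = 0 by rewrite /SX residual_invariant // mulmx0 singvals0.
clearbody SX; apply: (main (SY 0) sydec sy0) => f k kp.
apply: le_trans (bound f k kp) _.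
by apply: ler_sum => i _; rewrite SX0 add0r.
Qed.
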